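(* Let $k$ be an algebraically closed field, let $P$ be a finite poset, and let $I(P)$ be the incidence algebra of $P$ over $k$, regarded as an algebraic monoid (an affine space with its multiplication). Then the group $\mathrm{Aut}_{s.g.}(I(P))$ of algebraic semigroup automorphisms of $I(P)$ is equal to the group of $k$-algebra automorphisms of $I(P)$.
   Context: The incidence algebra of $P$ over $k$ is $I(P)=\{f:P\times P\to k : f(x,y)=0 \text{ unless } x\le y\}$ with pointwise addition and scalar multiplication and the convolution product $(f\cdot g)(x,y)=\sum_{x\le z\le y} f(x,z)g(z,y)$. As a variety, $I(P)$ is an affine space and the multiplication is a morphism, so $I(P)$ is a linear algebraic monoid. An algebraic semigroup automorphism of $I(P)$ is an automorphism of the variety $I(P)$ (a bijective morphism whose inverse is a morphism) that preserves multiplication. *)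

(* Defs.v *)
From HB Require Import structures.
From mathcomp Require Import all_boot all_order all_algebra.
From mathcomp.multinomials Require Import mpoly.

Set Implicit Arguments.
Unset Strict Implicit.
Unset Printing Implicit Defensive.

Import Order.TTheory GRing.Theory.
Local Open Scope ring_scope.

(* The incidence algebra is a pzRingType rather than an nzRingType: for the    *)
(* empty poset it is the zero ring. As lalgType/algType extend nzRingType, the *)
(* algebra structure is given by the lmodType and pzRingType instances and the *)
(* compatibility lemmas incidence_scalerAl and incidence_scalerAr.             *)

Section IncidenceAlgebra.
Context {disp : Order.disp_t}.
Variables (k : fieldType) (P : finPOrderType disp).

Definition is_incidence : {pred {ffun P * P -> k}} :=
  fun f => [forall u : P * P, ~~ (u.1 <= u.2)%O ==> (f u == 0)].

Record incidence : Type := Incidence {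
  incidence_val : {ffun P * P -> k};
  incidence_valP : is_incidence incidence_val
}.

Definition incidence_fun (f : incidence) (x y : P) : k := incidence_val f (x, y).
Coercion incidence_fun : incidence >-> Funclass.

HB.instance Definition _ := [isSub for incidence_val].
HB.instance Definition _ := [Choice of incidence by <:].

Lemma is_incidenceP (f : {ffun P * P -> k}) :
  reflect (forall x y, ~~ (x <= y)%O -> f (x, y) = 0) (is_incidence f).
Proof.
apply: (iffP forallP) => [H x y xy|H [x y]].
  by apply/eqP; have /implyP := H (x, y); apply.
by apply/implyP => /H ->.
Qed.

Lemma incidence_zmod_closed : zmod_closed is_incidence.
Proof.
split=> [|f g /is_incidenceP f0 /is_incidenceP g0]; apply/is_incidenceP.
  by move=> x y _; rewrite ffunE.
by move=> x y xy; rewrite !ffunE f0 // g0 // subr0.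
Qed.

HB.instance Definition _ :=
  GRing.isZmodClosed.Build {ffun P * P -> k} is_incidence
    incidence_zmod_closed.
HB.instance Definition _ := [SubChoice_isSubZmodule of incidence by <:].

Lemma incidence_out (f : incidence) x y : ~~ (x <= y)%O -> f x y = 0.
Proof. by move: x y; apply/is_incidenceP/incidence_valP. Qed.

Lemma incidenceP (f g : incidence) : f = g <-> (forall x y, f x y = g x y).
Proof.
split=> [-> //|fg]; apply/val_inj/ffunP => -[x y]; exact: fg.
Qed.

Definition incidence_scale_val (a : k) (f : incidence) : {ffun P * P -> k} :=
  [ffun u : P * P => a * f u.1 u.2].

Lemma incidence_scale_subproof a f : is_incidence (incidence_scale_val a f).
Proof.
by apply/is_incidenceP => x y xy; rewrite ffunE incidence_out // mulr0.
Qed.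

Definition incidence_scale a f := Incidence (incidence_scale_subproof a f).

Lemma incidence_addE (f g : incidence) x y : (f + g) x y = f x y + g x y.
Proof.
rewrite /incidence_fun.
have -> : incidence_val (f + g) = incidence_val f + incidence_val g.
  exact: (raddfD (val : incidence -> _)).
by rewrite ffunE.
Qed.

Lemma incidence_scale_funE a f x y : incidence_scale a f x y = a * f x y.
Proof. by rewrite /incidence_fun ffunE. Qed.

Lemma incidence_scaleA a b f :
  incidence_scale a (incidence_scale b f) = incidence_scale (a * b) f.
Proof. by apply/incidenceP => x y; rewrite !incidence_scale_funE mulrA. Qed.

Lemma incidence_scale1 : left_id 1 incidence_scale.
Proof. by move=> f; apply/incidenceP => x y; rewrite incidence_scale_funE mul1r. Qed.

Lemma incidence_scaleDr : right_distributive incidence_scale +%R.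
Proof.
move=> a f g; apply/incidenceP => x y.
by rewrite incidence_addE !incidence_scale_funE incidence_addE mulrDr.
Qed.

Lemma incidence_scaleDl f :
  {morph (fun a => incidence_scale a f) : a b / a + b >-> a + b}.
Proof.
move=> a b; apply/incidenceP => x y.
by rewrite incidence_addE !incidence_scale_funE mulrDl.
Qed.

HB.instance Definition _ := GRing.Zmodule_isLmodule.Build k incidence
  incidence_scaleA incidence_scale1 incidence_scaleDr incidence_scaleDl.

Lemma incidence_scaleE (a : k) (f : incidence) x y : (a *: f) x y = a * f x y.
Proof. exact: incidence_scale_funE. Qed.

Definition incidence_one_val : {ffun P * P -> k} :=
  [ffun u : P * P => (u.1 == u.2)%:R].

Lemma incidence_one_subproof : is_incidence incidence_one_val.
Proof.
apply/is_incidenceP => x y; rewrite ffunE /=.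
by case: eqP => [->|//]; rewrite lexx.
Qed.

Definition incidence_one := Incidence incidence_one_subproof.

Definition incidence_mul_val (f g : incidence) : {ffun P * P -> k} :=
  [ffun u : P * P => \sum_(z : P | (u.1 <= z <= u.2)%O) f u.1 z * g z u.2].

Lemma incidence_mul_subproof f g : is_incidence (incidence_mul_val f g).
Proof.
apply/is_incidenceP => x y xy; rewrite ffunE big_pred0 // => z /=.
by apply: contraNF xy => /andP[]; apply: le_trans.
Qed.

Definition incidence_mul f g := Incidence (incidence_mul_subproof f g).

Lemma incidence_oneE x y : incidence_one x y = (x == y)%:R.
Proof. by rewrite /incidence_fun ffunE. Qed.

Lemma incidence_mul_intervalE f g x y :
  incidence_mul f g x y = \sum_(z | (x <= z <= y)%O) f x z * g z y.
Proof. by rewrite /incidence_fun ffunE. Qed.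

Lemma incidence_mul_allE f g x y :
  incidence_mul f g x y = \sum_z f x z * g z y.
Proof.
rewrite incidence_mul_intervalE [RHS](bigID (fun z => x <= z <= y)%O) /=.
rewrite [X in _ + X]big1 ?addr0 // => z; rewrite negb_and.
by case/orP => /incidence_out ->; rewrite ?mul0r ?mulr0.
Qed.

Lemma incidence_mulA : associative incidence_mul.
Proof.
move=> f g h; apply/incidenceP => x y; rewrite !incidence_mul_allE.
under eq_bigr do rewrite incidence_mul_allE mulr_sumr.
rewrite exchange_big; apply: eq_bigr => z _.
by rewrite incidence_mul_allE mulr_suml; apply: eq_bigr => t _; rewrite mulrA.
Qed.

Lemma incidence_mul1 : left_id incidence_one incidence_mul.
Proof.
move=> f; apply/incidenceP => x y; rewrite incidence_mul_allE (bigD1 x) //=.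
rewrite big1 => [|z zx]; rewrite incidence_oneE ?eqxx ?mul1r ?addr0 //.
by rewrite eq_sym (negPf zx) mul0r.
Qed.

Lemma incidence_mulr1 : right_id incidence_one incidence_mul.
Proof.
move=> f; apply/incidenceP => x y; rewrite incidence_mul_allE (bigD1 y) //=.
rewrite big1 => [|z zy]; rewrite incidence_oneE ?eqxx ?mulr1 ?addr0 //.
by rewrite (negPf zy) mulr0.
Qed.

Lemma incidence_mulDl : left_distributive incidence_mul +%R.
Proof.
move=> f g h; apply/incidenceP => x y.
rewrite incidence_addE !incidence_mul_allE -big_split; apply: eq_bigr => z _.
by rewrite incidence_addE mulrDl.
Qed.

Lemma incidence_mulDr : right_distributive incidence_mul +%R.
Proof.
move=> f g h; apply/incidenceP => x y.
rewrite incidence_addE !incidence_mul_allE -big_split; apply: eq_bigr => z _.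
by rewrite incidence_addE mulrDr.
Qed.

HB.instance Definition _ := GRing.Zmodule_isPzRing.Build incidence
  incidence_mulA incidence_mul1 incidence_mulr1 incidence_mulDl incidence_mulDr.

Lemma incidence_mulE (f g : incidence) x y :
  (f * g) x y = \sum_(z | (x <= z <= y)%O) f x z * g z y.
Proof. exact: incidence_mul_intervalE. Qed.

Lemma incidence_scalerAl (a : k) (f g : incidence) : a *: (f * g) = (a *: f) * g.
Proof.
apply/incidenceP => x y; rewrite incidence_scaleE !incidence_mulE mulr_sumr.
by apply: eq_bigr => z _; rewrite incidence_scaleE mulrA.
Qed.

Lemma incidence_scalerAr (a : k) (f g : incidence) : a *: (f * g) = f * (a *: g).
Proof.
apply/incidenceP => x y; rewrite incidence_scaleE !incidence_mulE mulr_sumr.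
by apply: eq_bigr => z _; rewrite incidence_scaleE mulrCA.
Qed.

End IncidenceAlgebra.

Arguments incidence {disp} k P.

(* A set of self-maps of T that is a group under composition, i.e. a subgroup  *)
(* of the group of bijections of T. Two such groups are equal when they have   *)
(* the same elements.                                                          *)
Record transf_group (T : Type) : Type := TransfGroup {
  transf_mem :> (T -> T) -> Prop;
  transf_id : transf_mem idfun;
  transf_comp : forall f g, transf_mem f -> transf_mem g -> transf_mem (f \o g);
  transf_inv : forall f, transf_mem f ->
    exists g, [/\ transf_mem g, cancel f g & cancel g f]
}.

Section Automorphisms.
Context {disp : Order.disp_t}.
Variables (k : fieldType) (P : finPOrderType disp).
Local Notation I := (incidence k P).

(* The coordinates on the affine space I(P) are the entries f(x,y), x <= y. *)
Definition comparable_pair : Type := {u : P * P | (u.1 <= u.2)%O}.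
HB.instance Definition _ := SubFinite.on comparable_pair.

Definition coord (f : I) (u : comparable_pair) : k := f (val u).1 (val u).2.

Definition coords (f : I) (i : 'I_#|{: comparable_pair}|) : k :=
  coord f (enum_val i).

Definition is_morphism (phi : I -> I) : Prop :=
  forall u : comparable_pair,
    exists p : {mpoly k[#|{: comparable_pair}|]},
      forall f : I, coord (phi f) u = p.@[coords f].

Definition is_variety_automorphism (phi : I -> I) : Prop :=
  is_morphism phi /\
  exists psi : I -> I, [/\ is_morphism psi, cancel phi psi & cancel psi phi].

Definition is_sg_automorphism (phi : I -> I) : Prop :=
  is_variety_automorphism phi /\ {morph phi : f g / f * g}.

Definition is_algebra_automorphism (phi : I -> I) : Prop :=
  [/\ bijective phi, linear phi & monoid_morphism phi].

Lemma is_morphism_id : is_morphism idfun.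
Proof.
move=> u; exists 'X_(enum_rank u) => f.
by rewrite mevalXU /coords enum_rankK.
Qed.

Lemma is_morphism_comp phi psi :
  is_morphism phi -> is_morphism psi -> is_morphism (phi \o psi).
Proof.
move=> phiP psiP u; have [p pP] := phiP u.
have [q qP] := fin_all_exists psiP.
exists (p \mPo [tuple q (enum_val i) | i < #|{: comparable_pair}|]) => f.
rewrite /= pP comp_mpoly_meval; apply: meval_eq => i.
by rewrite /coords qP tnth_mktuple.
Qed.

Lemma is_sg_automorphism_id : is_sg_automorphism idfun.
Proof.
by split=> //; split; [|exists idfun; split=> //]; exact: is_morphism_id.
Qed.

Lemma is_sg_automorphism_comp phi psi :
  is_sg_automorphism phi -> is_sg_automorphism psi ->
  is_sg_automorphism (phi \o psi).
Proof.
move=> [[phiM [phi' [phi'M phiK phi'K]]] phi_mul].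
move=> [[psiM [psi' [psi'M psiK psi'K]]] psi_mul].
split; last by move=> f g; rewrite /= psi_mul phi_mul.
split; first exact: is_morphism_comp.
exists (psi' \o phi'); split; first exact: is_morphism_comp.
  exact: can_comp.
exact: can_comp.
Qed.

Lemma is_sg_automorphism_inv phi : is_sg_automorphism phi ->
  exists psi, [/\ is_sg_automorphism psi, cancel phi psi & cancel psi phi].
Proof.
move=> [[phiM [psi [psiM phiK psiK]]] phi_mul].
exists psi; split=> //; split; first by split=> //; exists phi; split.
by move=> f g; apply: (can_inj phiK); rewrite phi_mul !psiK.
Qed.

Lemma is_algebra_automorphism_id : is_algebra_automorphism idfun.
Proof. by split=> //; exists idfun. Qed.

Lemma is_algebra_automorphism_comp phi psi :
  is_algebra_automorphism phi -> is_algebra_automorphism psi ->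
  is_algebra_automorphism (phi \o psi).
Proof.
move=> [phiB phiL [phi1 phiM]] [psiB psiL [psi1 psiM]]; split.
- exact: bij_comp.
- by move=> a f g; rewrite /= psiL phiL.
- by split=> [|f g]; rewrite /= ?psi1 // psiM phiM.
Qed.

Lemma is_algebra_automorphism_inv phi : is_algebra_automorphism phi ->
  exists psi, [/\ is_algebra_automorphism psi, cancel phi psi & cancel psi phi].
Proof.
move=> [[psi phiK psiK] phiL [phi1 phiM]]; exists psi; split=> //; split.
- by exists phi.
- by move=> a f g; apply: (can_inj phiK); rewrite phiL !psiK.
- by split=> [|f g]; apply: (can_inj phiK); rewrite ?phiM !psiK.
Qed.

Definition Aut_sg : transf_group I :=
  TransfGroup is_sg_automorphism_id is_sg_automorphism_comp
    is_sg_automorphism_inv.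

Definition Aut_alg : transf_group I :=
  TransfGroup is_algebra_automorphism_id is_algebra_automorphism_comp
    is_algebra_automorphism_inv.

End Automorphisms.

Arguments Aut_sg {disp} k P.
Arguments Aut_alg {disp} k P.

(* Main.v *)
From HB Require Import structures.
Require Import Defs.
From mathcomp Require Import all_boot all_order all_algebra.
From mathcomp.multinomials Require Import mpoly.

(* Let phi be an algebraic semigroup automorphism, e_x the diagonal matrix      *)
(* units and E_x := phi e_x. The E_x are nonzero orthogonal idempotents, as     *)
(* many as there are diagonal entries, so each has exactly one nonzero diagonal *)
(* entry and they sum to 1. Hence E_x I(P) E_x = k E_x, so t |-> phi (t e_x) is *)
(* chi(t) E_x for a polynomial chi having a polynomial left inverse; thus chi   *)
(* is affine, and chi(0) = 0, chi(1) = 1 give phi (t e_x) = t E_x. As           *)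
(* E_x (phi f) E_y = phi (e_x f e_y) = f(x,y) phi (e_xy), summing over x and y  *)
(* shows that phi is linear.                                                    *)

Set Implicit Arguments.
Unset Strict Implicit.
Unset Printing Implicit Defensive.

Import Order.TTheory GRing.Theory.
Local Open Scope ring_scope.

(** Multiplicativity reduces linearity to the scalars on each diagonal unit. [ortho_idempotents]
    shows that the images of these units again form a complete orthogonal system,
    [idempotent_corner] makes their corners one-dimensional, and [left_invertible_poly] forces the
    induced map on scalars to be the identity. [sg_aut_sum] assembles linearity from the corners.
    Conversely, a linear map is polynomial in the entries ([linear_is_morphism]), and so is its
    linear inverse. *)

Section IncidenceEntries.
Context {disp : Order.disp_t} (k : fieldType) (P : finPOrderType disp).
Local Notation I := (incidence k P).
Implicit Types (f g A B E N : I) (x y z : P) (t : k).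

(** * Entries, diagonals and idempotents *)

Lemma incidence_zeroE x y : (0 : I) x y = 0.
Proof. by rewrite -(scale0r 0) incidence_scaleE mul0r. Qed.

Lemma incidence_unitE x y : (1 : I) x y = (x == y)%:R.
Proof. exact: incidence_oneE. Qed.

Lemma incidence_subE f g x y : (f - g) x y = f x y - g x y.
Proof. by rewrite -scaleN1r incidence_addE incidence_scaleE mulN1r. Qed.

Lemma incidence_sumE (T : finType) (F : T -> I) x y :
  (\sum_i F i) x y = \sum_i F i x y.
Proof.
apply: (big_morph (fun f : I => f x y)) => [f g|].
  exact: incidence_addE.
exact: incidence_zeroE.
Qed.

Lemma incidence_mul_sumE f g x y : (f * g) x y = \sum_z f x z * g z y.
Proof. exact: incidence_mul_allE. Qed.

Lemma incidence_mul_diag f g x : (f * g) x x = f x x * g x x.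
Proof.
rewrite incidence_mulE (bigD1 x) ?lexx //= big1 ?addr0 // => z.
by rewrite -eq_le eq_sym => /andP[->].
Qed.

(* Entries of N = A N B vanish by induction on the size of the interval [x,y]:  *)
(* only the term A x x * N x y * B y y can involve N outside shorter intervals. *)
Lemma sandwich_eq0 A N B :
  A * N * B = N -> (forall x y, A x x * N x y * B y y = 0) -> N = 0.
Proof.
move=> AN d0; apply/incidenceP => x y; rewrite incidence_zeroE.
move: {2}#|_| (leqnn #|[set z | x <= z <= y]%O|) => n.
elim: n x y => [|n IH] x y len.
  apply: incidence_out; apply/negP => xy.
  move: len; rewrite leqn0 cards_eq0 => /eqP/setP/(_ x).
  by rewrite !inE lexx xy.
have [xy|/incidence_out->//] := boolP (x <= y)%O.
rewrite -AN incidence_mulE big1 // => d /andP[xd dy].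
rewrite incidence_mulE mulr_suml big1 // => c /andP[xc cd].
have [/andP[/eqP-> /eqP->]//|] := boolP ((c == x) && (d == y)).
rewrite negb_and => cx_dy.
rewrite IH ?mulr0 ?mul0r // -ltnS; apply: leq_trans len.
apply: proper_card; apply/properP; split.
  apply/subsetP => z; rewrite !inE => /andP[cz zd].
  by rewrite (le_trans xc cz) (le_trans zd dy).
case/orP: cx_dy => [cx|dny].
  exists x; rewrite !inE ?lexx ?xy // negb_and; apply/orP; left.
  by apply: contra cx => lecx; rewrite eq_le lecx.
exists y; rewrite !inE ?lexx ?xy // negb_and; apply/orP; right.
by apply: contra dny => yd; rewrite eq_le dy yd.
Qed.

Lemma idempotent_eq0 E : E * E = E -> (forall x, E x x = 0) -> E = 0.
Proof.
move=> EE E0; apply: (@sandwich_eq0 E E 1) => [|x y]; first by rewrite mulr1.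
by rewrite E0 !mul0r.
Qed.

(** The complement [1 - E] is an idempotent with zero diagonal. *)
Lemma idempotent_eq1 E : E * E = E -> (forall x, E x x = 1) -> E = 1.
Proof.
move=> EE E1; apply/esym/eqP; rewrite -subr_eq0; apply/eqP.
apply: idempotent_eq0 => [|x].
  by rewrite mulrBl mul1r mulrBr mulr1 EE subrr subr0.
by rewrite incidence_subE incidence_unitE eqxx E1 subrr.
Qed.

(** The difference of the two sides is fixed by multiplication by [E] on both sides, and its entry
    at [(s, s)] is zero, so [sandwich_eq0] applies. *)
Lemma idempotent_corner E f s : E * E = E -> E s s = 1 ->
  (forall x, x != s -> E x x = 0) -> E * f * E = f s s *: E.
Proof.
move=> EE Es E0; apply/eqP; rewrite -subr_eq0; apply/eqP.
apply: (@sandwich_eq0 E _ E) => [|x y].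
  rewrite mulrBr mulrBl -incidence_scalerAr -incidence_scalerAl !EE.
  by rewrite -!mulrA EE !mulrA EE.
have [->|/E0->] := eqVneq x s; last by rewrite !mul0r.
have [->|/E0->] := eqVneq y s; last by rewrite mulr0.
rewrite incidence_subE incidence_scaleE !incidence_mul_diag Es.
by rewrite !mulr1 !mul1r subrr.
Qed.

(** * Matrix units *)

Definition delta_val x y : {ffun P * P -> k} :=
  [ffun u => ((x <= y)%O && (u == (x, y)))%:R].

Lemma delta_subproof x y : is_incidence (delta_val x y).
Proof.
apply/is_incidenceP => a b; rewrite ffunE.
have [[-> -> /negPf->//]|] := eqVneq (a, b) (x, y); by rewrite andbF.
Qed.

(* The matrix unit at (x,y); it is 0 when x is not below y. *)
Definition delta x y : I := Incidence (delta_subproof x y).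

Lemma deltaE x y a b : delta x y a b = [&& (x <= y)%O, a == x & b == y]%:R.
Proof. by rewrite /incidence_fun ffunE. Qed.

Lemma delta_mull x y f a b : (x <= y)%O ->
  (delta x y * f) a b = (a == x)%:R * f y b.
Proof.
move=> xy; rewrite incidence_mul_sumE (bigD1 y) //= deltaE xy eqxx andbT.
rewrite big1 ?addr0 // => z zy.
by rewrite deltaE (negPf zy) !andbF mul0r.
Qed.

Lemma delta_mulr x y f a b : (x <= y)%O ->
  (f * delta x y) a b = f a x * (b == y)%:R.
Proof.
move=> xy; rewrite incidence_mul_sumE (bigD1 x) //= deltaE xy eqxx.
rewrite big1 ?addr0 // => z zx.
by rewrite deltaE (negPf zx) andbF mulr0.
Qed.

Lemma delta_sandwich x y f : delta x x * f * delta y y = f x y *: delta x y.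
Proof.
apply/incidenceP => a b; rewrite delta_mulr // delta_mull // incidence_scaleE.
rewrite deltaE; have [_|/incidence_out->] := boolP (x <= y)%O.
  by rewrite /= mulrAC -natrM mulnb mulrC.
by rewrite mulr0 !mul0r.
Qed.

Lemma delta_idem x : delta x x * delta x x = delta x x.
Proof.
by apply/incidenceP => a b; rewrite delta_mull // !deltaE lexx /= eqxx -natrM mulnb.
Qed.

Lemma delta_ortho x y : x != y -> delta x x * delta y y = 0.
Proof.
move=> xy; apply/incidenceP => a b.
by rewrite delta_mull // deltaE (negPf xy) andbF mulr0 incidence_zeroE.
Qed.

Lemma delta_mul_delta x y : delta x x * delta x y = delta x y.
Proof.
by apply/incidenceP => a b; rewrite delta_mull // !deltaE eqxx /=
  -natrM mulnb andbCA.
Qed.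

Lemma delta_neq0 x : delta x x != 0.
Proof.
apply/eqP => /incidenceP/(_ x x); rewrite deltaE lexx !eqxx incidence_zeroE.
by apply/eqP; rewrite oner_eq0.
Qed.

Lemma incidence_sum_delta f :
  f = \sum_(u : comparable_pair P) Defs.coord f u *: delta (val u).1 (val u).2.
Proof.
apply/incidenceP => a b.
have [ab|nab] := boolP (a <= b)%O; last by rewrite !incidence_out.
pose u : comparable_pair P := exist _ (a, b) ab.
rewrite incidence_sumE (bigD1 u) //= big1 => [|v vu].
  by rewrite incidence_scaleE deltaE ab !eqxx mulr1 addr0.
rewrite incidence_scaleE deltaE; have /negPf-> : ~~ ((a == (val v).1) && (b == (val v).2)).
  by apply: contra vu => /andP[/eqP av /eqP bv]; rewrite -val_eqE /= av bv -surjective_pairing.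
by rewrite andbF mulr0.
Qed.

(** Diagonal entries of an idempotent are 0 or 1. Orthogonality makes the diagonal supports
    disjoint, and [idempotent_eq0] makes them nonempty; being indexed by [P] itself, they must be
    singletons covering the diagonal. *)
Lemma ortho_idempotents (E : P -> I) :
    (forall x, E x * E x = E x) -> (forall x y, x != y -> E x * E y = 0) ->
    (forall x, E x != 0) ->
  exists2 s : P -> P, forall x, E x (s x) (s x) = 1 /\
      (forall y, y != s x -> E x y y = 0) & \sum_x E x = 1.
Proof.
move=> Eidem Eortho Eneq0.
have diag01 x y : E x y y != 0 -> E x y y = 1.
  move=> nz; apply: (mulfI nz); rewrite mulr1 -incidence_mul_diag.
  by rewrite Eidem.
have disjoint x x' y : E x y y != 0 -> E x' y y != 0 -> x = x'.
  move=> nz nz'; apply/eqP; apply: contraT => /Eortho xx'.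
  have := incidence_mul_diag (E x) (E x') y.
  by rewrite xx' incidence_zeroE => /esym/eqP; rewrite mulf_eq0 (negPf nz) (negPf nz').
have /fin_all_exists[s sP] x : exists y, E x y y != 0.
  apply/existsP; apply: contraNT (Eneq0 x).
  rewrite negb_exists => /forallP d0; apply/eqP/idempotent_eq0 => // y.
  by apply/eqP; have := d0 y; rewrite negbK.
have s_inj : injective s.
  by move=> x x' ss'; apply: (disjoint x x' (s x)) => //; rewrite ss'.
(* An injective self-map of the finite set [P] is bijective, so every diagonal position [y] is
   already taken by [E (s' y)]. *)
have [s' sK s'K] := injF_bij s_inj.
have E0 x y : y != s x -> E x y y = 0.
  move=> ysx; apply/eqP; apply: contraNT ysx => nz.
  by rewrite (disjoint x (s' y) y nz) ?s'K // -{2 3}[y]s'K.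
exists s => [x|]; first by split=> [|y]; [exact: diag01 | exact: E0].
apply: idempotent_eq1 => [|y].
  rewrite mulr_suml; apply: eq_bigr => x _; rewrite mulr_sumr (bigD1 x) //=.
  by rewrite Eidem big1 ?addr0 // => x' x'x; rewrite Eortho // eq_sym.
rewrite incidence_sumE -[y]s'K (bigD1 (s' y)) //= diag01 // big1 ?addr0 //.
by move=> x xy; rewrite E0 // inj_eq // eq_sym.
Qed.

(** * Polynomial maps and their restriction to lines *)

Lemma linear_is_morphism (phi : I -> I) : linear phi -> is_morphism phi.
Proof.
move=> phi_lin v.
pose phiL := HB.pack_for {linear I -> I} phi (GRing.isLinear.Build k I I _ phi phi_lin).
exists (\sum_i Defs.coord (phi (delta (val (enum_val i)).1 (val (enum_val i)).2)) v *: 'X_i).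
move=> f; rewrite raddf_sum /=; under eq_bigr do rewrite mevalZ mevalXU.
rewrite {1}[f]incidence_sum_delta (reindex _ (onW_bij _ (enum_val_bij _))) /=.
rewrite -[phi _]/(phiL _) linear_sum /Defs.coord incidence_sumE; apply: eq_bigr => i _.
by rewrite linearZ incidence_scaleE mulrC.
Qed.

Lemma meval_poly (n : nat) (p : {mpoly k[n]}) (v : 'I_n -> {poly k}) :
  exists q : {poly k}, forall t, p.@[fun i => (v i).[t]] = q.[t].
Proof.
exists (mmap polyC v p) => t; rewrite mevalE /mmap horner_sum.
apply: eq_bigr => m _; rewrite hornerM hornerC horner_prod.
by congr (_ * _); apply: eq_bigr => i _; rewrite horner_exp.
Qed.

Lemma morphism_line (phi : I -> I) f x : is_morphism phi ->
  exists q : {poly k}, forall t, phi (t *: f) x x = q.[t].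
Proof.
move=> phiM; have [p pP] := phiM (exist _ (x, x) (lexx x)).
have [q qP] := meval_poly p (fun i => (coords f i)%:P * 'X).
exists q => t; rewrite -qP; have := pP (t *: f); rewrite /Defs.coord /= => ->.
apply: meval_eq => i; rewrite hornerM hornerC hornerX mulrC.
by rewrite /Defs.coords /Defs.coord incidence_scaleE.
Qed.

End IncidenceEntries.

(** The polynomial [q + 1] takes only the value 1, so it has no root and must be constant. *)
Lemma closed_poly_eq0 (k : closedFieldType) (q : {poly k}) :
  (forall t, q.[t] = 0) -> q = 0.
Proof.
move=> q0; have [/size_poly1P[c c0 qc]|/closed_rootP[t]] := boolP (size (q + 1) == 1%N).
  have qE : q = (c - 1)%:P by rewrite polyCB -qc addrK.
  by have := q0 0; rewrite qE hornerC => ->.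
by rewrite rootE hornerD q0 hornerC add0r oner_eq0.
Qed.

(** Degrees multiply under composition and [p \Po q] is ['X], so [q] is affine. In characteristic p
    the bijection [t ^+ p] also fixes 0 and 1; the polynomial left inverse excludes it. *)
Lemma left_invertible_poly (k : closedFieldType) (p q : {poly k}) :
  (forall t, p.[q.[t]] = t) -> q.[0] = 0 -> q.[1] = 1 -> forall t, q.[t] = t.
Proof.
move=> pq q0 q1.
have pqX : p \Po q = 'X.
  apply/eqP; rewrite -subr_eq0; apply/eqP/closed_poly_eq0 => t.
  by rewrite !hornerE horner_comp pq subrr.
have : ((size q).-1 == 1)%N.
  have := size_comp_poly p q; rewrite pqX size_polyX /= => /esym/eqP.
  by rewrite muln_eq1 => /andP[].
move=> sq; have {}sq : (size q <= 2)%N by case: (size q) sq => [|[|[]]].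
have qE t : q.[t] = q`_0 + q`_1 * t.
  by rewrite (horner_coef_wide _ sq) !big_ord_recl big_ord0 /= expr0 mulr1 expr1 addr0.
move: q0 q1; rewrite !qE mulr0 addr0 => q00; rewrite q00 add0r mulr1 => q01 t.
by rewrite qE q00 q01 mul1r add0r.
Qed.

(** * Linearity of semigroup automorphisms *)

Section SemigroupAutomorphism.
Context {disp : Order.disp_t} (k : closedFieldType) (P : finPOrderType disp).
Local Notation I := (incidence k P).
Variables phi psi : I -> I.
Hypotheses (phiM : is_morphism phi) (psiM : is_morphism psi).
Hypotheses (phiK : cancel phi psi) (psiK : cancel psi phi).
Hypothesis phi_mul : {morph phi : f g / f * g}.

(** Surjectivity is what counts: [phi 0] absorbs every element of the image, including 0. *)
Lemma sg_aut0 : phi 0 = 0.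
Proof. by rewrite -[in LHS](mul0r (psi 0)) phi_mul psiK mulr0. Qed.

Lemma sg_aut1 : phi 1 = 1.
Proof. by rewrite -[LHS]mulr1 -[X in _ * X]psiK -phi_mul mul1r psiK. Qed.

Let E x := phi (delta k x x).

Lemma sg_aut_delta_idempotents :
  exists2 s : P -> P, forall x, E x (s x) (s x) = 1 /\
      (forall y, y != s x -> E x y y = 0) & \sum_x E x = 1.
Proof.
apply: ortho_idempotents => [x|x y xy|x]; rewrite /E -?phi_mul.
- by rewrite delta_idem.
- by rewrite delta_ortho // sg_aut0.
by rewrite -sg_aut0 (inj_eq (can_inj phiK)) delta_neq0.
Qed.

Lemma sg_aut_scale_diag x t : phi (t *: delta k x x) = t *: E x.
Proof.
have [s sP _] := sg_aut_delta_idempotents; have [Es E0] := sP x.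
have EE : E x * E x = E x by rewrite -phi_mul delta_idem.
have [chi chiP] := morphism_line (delta k x x) (s x) phiM.
(* Reading [psi] along the line through [E x] gives the polynomial left inverse of [chi]. *)
have [eta etaP] := morphism_line (E x) x psiM.
(* Since [u *: delta k x x] lies in the corner of [delta k x x], its image lies in the corner of
   [E x]. *)
have corner u : phi (u *: delta k x x) = chi.[u] *: E x.
  rewrite -chiP -(idempotent_corner _ EE Es E0) -!phi_mul.
  by rewrite -incidence_scalerAr -incidence_scalerAl !delta_idem.
rewrite corner (@left_invertible_poly _ eta) // => [u||].
- by rewrite -etaP -corner phiK incidence_scaleE deltaE lexx !eqxx mulr1.
- by rewrite -chiP scale0r sg_aut0 incidence_zeroE.
by rewrite -chiP scale1r.
Qed.

Lemma sg_aut_scale_delta x y t : phi (t *: delta k x y) = t *: phi (delta k x y).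
Proof.
rewrite -delta_mul_delta incidence_scalerAl phi_mul sg_aut_scale_diag.
by rewrite -incidence_scalerAl -phi_mul.
Qed.

(** Multiplying [phi f] by the sum of the [E x], which is 1, on both sides is a Peirce
    decomposition, and each piece is the image of a multiple of a matrix unit. *)
Lemma sg_aut_sum f : phi f = \sum_x \sum_y f x y *: phi (delta k x y).
Proof.
have [s _ sumE] := sg_aut_delta_idempotents.
rewrite -[LHS]mul1r -[LHS]mulr1 -sumE !mulr_suml; apply: eq_bigr => x _.
rewrite mulr_sumr; apply: eq_bigr => y _.
by rewrite -!phi_mul delta_sandwich sg_aut_scale_delta.
Qed.

Lemma sg_aut_linear : linear phi.
Proof.
move=> a f g; rewrite !(sg_aut_sum f, sg_aut_sum g, sg_aut_sum (_ + _)).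
rewrite scaler_sumr -big_split; apply: eq_bigr => x _ /=.
rewrite scaler_sumr -big_split; apply: eq_bigr => y _ /=.
by rewrite incidence_addE incidence_scaleE scalerDl scalerA.
Qed.

End SemigroupAutomorphism.

Theorem theorem1p1 (disp : Order.disp_t) (k : closedFieldType)
    (P : finPOrderType disp) (phi : incidence k P -> incidence k P) :
  Aut_sg k P phi <-> Aut_alg k P phi.
Proof.
split=> [[[phiM [psi [psiM phiK psiK]]] phi_mul]|phiA].
  split; first by exists psi.
    exact: (sg_aut_linear phiM psiM phiK psiK phi_mul).
  by split=> //; exact: (sg_aut1 psiK phi_mul).
have [psi [[_ psi_lin _] phiK psiK]] := is_algebra_automorphism_inv phiA.
have [_ phi_lin [_ phi_mul]] := phiA.
split=> //; split; first exact: linear_is_morphism.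
by exists psi; split=> //; exact: linear_is_morphism.
Qed.
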